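(* Let $A\in\mathbb{R}^{m\times n}$ be a full column-rank matrix. If $A(\mathbb{R}^n)\cap\mathbb{R}^m_{++}\neq\emptyset$, then $H(A)=1/\mathcal{R}(A)$. Consequently, if all rows of the full column-rank matrix $A\in\mathbb{R}^{m\times n}$ are nonzero (with or without the condition $A(\mathbb{R}^n)\cap\mathbb{R}^m_{++}\neq\emptyset$), then $$\chi(A)=\max\left\{\frac{1}{\mathcal{R}(SA)}: S\in\mathscr{S},\ SA(\mathbb{R}^n)\cap\mathbb{R}^m_{++}\neq\emptyset\right\}.$$
   Context: Here $m,n\ge 1$; $\mathbb{R}^d$ carries the Euclidean norm $\|\cdot\|$ and matrices carry the induced operator norm $\|M\|=\max_{\|x\|\le 1}\|Mx\|$. $\mathbb{R}^m_+$ and $\mathbb{R}^m_{++}$ are the sets of vectors in $\mathbb{R}^m$ with nonnegative, respectively positive, entries, and $A(\mathbb{R}^n):=\{Ax:x\in\mathbb{R}^n\}$. $\mathscr{S}:=\{\operatorname{Diag}(s): s\in\{-1,1\}^m\}\subseteq\mathbb{R}^{m\times m}$ is the set of signature matrices and $\mathscr{D}:=\{\operatorname{Diag}(d): d\in\mathbb{R}^m_{++}\}$ is the set of diagonal matrices with positive diagonal entries. Chi constant: for $A\in\mathbb{R}^{m\times n}$ of full column rank define $\chi(A):=\sup_{D\in\mathscr{D}}\|(A^{\mathsf T}DA)^{-1}A^{\mathsf T}D\|$, which is known to be finite. Hoffman constant: for a nonzero $A\in\mathbb{R}^{m\times n}$ and $b\in\mathbb{R}^m$ let $P_A(b):=\{x\in\mathbb{R}^n: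 Ax\le b\}$ (componentwise inequality), which is nonempty if and only if $b\in A(\mathbb{R}^n)+\mathbb{R}^m_+$. Define $$H(A):=\sup\left\{\frac{\operatorname{dist}(x,P_A(b))}{\|(Ax-b)_+\|}: b\in A(\mathbb{R}^n)+\mathbb{R}^m_+,\ x\in\mathbb{R}^n\setminus P_A(b)\right\},$$ which is known to be finite, where $\operatorname{dist}(u,T)=\inf_{v\in T}\|u-v\|$ and $(\cdot)_+$ is the componentwise positive part. Renegar's distance to infeasibility: for $A\in\mathbb{R}^{m\times n}$ with $A(\mathbb{R}^n)\cap\mathbb{R}^m_{++}\neq\emptyset$, $$\mathcal{R}(A):=\inf\{\|\Delta A\|: \Delta A\in\mathbb{R}^{m\times n},\ (A+\Delta A)(\mathbb{R}^n)\cap\mathbb{R}^m_{++}=\emptyset\}.$$ *)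

(* Defs.v *)
From mathcomp Require Import all_boot all_order all_algebra.
From mathcomp Require Import all_classical all_reals all_analysis.

Set Implicit Arguments.
Unset Strict Implicit.
Unset Printing Implicit Defensive.

Import Order.TTheory GRing.Theory Num.Theory.

Local Open Scope classical_set_scope.
Local Open Scope ring_scope.

(* The library norm on matrices is the entrywise maximum; the Euclidean norm
   and the operator norm it induces are therefore introduced here. *)
Definition enorm (R : realType) (d : nat) (x : 'cV[R]_d) : R :=
  Num.sqrt (\sum_i x i 0 ^+ 2).

(* The set is nonempty and bounded, and the supremum is attained. *)
Definition opnorm (R : realType) (p q : nat) (M : 'M[R]_(p, q)) : R :=
  sup [set enorm (M *m x) | x in [set x : 'cV[R]_q | enorm x <= 1]].

Definition edist (R : realType) (d : nat) (u : 'cV[R]_d)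
    (T : set 'cV[R]_d) : R :=
  inf [set enorm (u - v) | v in T].

Definition nonneg_orthant (R : realType) (m : nat) : set 'cV[R]_m :=
  [set y | forall i, 0 <= y i 0].

Definition pos_orthant (R : realType) (m : nat) : set 'cV[R]_m :=
  [set y | forall i, 0 < y i 0].

Definition pospart (R : realType) (m : nat) (y : 'cV[R]_m) : 'cV[R]_m :=
  map_mx (fun t => Num.max t 0) y.

Definition colspace (R : realType) (m n : nat) (A : 'M[R]_(m, n)) :
    set 'cV[R]_m :=
  range (fun x : 'cV[R]_n => A *m x).

Definition signature_mx (R : realType) (m : nat) : set 'M[R]_m :=
  [set diag_mx s | s in [set s : 'rV[R]_m | forall i, s 0 i = -1 \/ s 0 i = 1]].

Definition posdiag_mx (R : realType) (m : nat) : set 'M[R]_m :=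
  [set diag_mx d | d in [set d : 'rV[R]_m | forall i, 0 < d 0 i]].

(* Meaningful for A of full column rank, in which case A^T *m D *m A is
   invertible.  The supremum is taken in \bar R, so that an equation
   chi A = r%:E with r : R includes finiteness; likewise for hoffman. *)
Definition chi (R : realType) (m n : nat) (A : 'M[R]_(m, n)) : \bar R :=
  ereal_sup [set (opnorm (invmx (A^T *m D *m A) *m A^T *m D))%:E
            | D in @posdiag_mx R m].

Definition polyhedron (R : realType) (m n : nat) (A : 'M[R]_(m, n))
    (b : 'cV[R]_m) : set 'cV[R]_n :=
  [set x | forall i, (A *m x) i 0 <= b i 0].

(* Meaningful for A != 0.  The two constraints on the pair (b, x) make
   polyhedron A b nonempty and the denominator nonzero. *)
Definition hoffman (R : realType) (m n : nat) (A : 'M[R]_(m, n)) : \bar R :=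
  ereal_sup
    [set (edist p.2 (polyhedron A p.1) / enorm (pospart (A *m p.2 - p.1)))%:E
    | p in [set p : 'cV[R]_m * 'cV[R]_n |
             [set y + z | y in colspace A & z in @nonneg_orthant R m] p.1
             /\ ~ polyhedron A p.1 p.2]].

Definition strictly_feasible (R : realType) (m n : nat) (A : 'M[R]_(m, n)) :
    Prop :=
  colspace A `&` @pos_orthant R m !=set0.

(* Meaningful for strictly feasible A.  The infimum is over a nonempty set
   (B = - A qualifies when m > 0) of nonnegative reals. *)
Definition renegar (R : realType) (m n : nat) (A : 'M[R]_(m, n)) : R :=
  inf [set opnorm B | B in [set B : 'M[R]_(m, n) |
                             colspace (A + B) `&` @pos_orthant R m = set0]].

Definition is_max (disp : Order.disp_t) (T : porderType disp) (E : set T)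
    (x : T) : Prop :=
  E x /\ ubound E x.

(* Main.v *)
(* Everything reduces to the scale [r(A) = inf |A^T v| / |v|] over nonzero
   vectors [v >= 0].

   Renegar: if [(A + B) x > 0] has no solution then, by a Gordan-type
   alternative, [|(A + B)^T v| / |v|] is not bounded away from 0 over [v >= 0],
   which forces [|B| >= r(A)]; conversely [B = - v v^T A / |v|^2] makes [v]
   orthogonal to the column space of [A + B].

   Hoffman: a maximizer [v >= 0] of [v.(A x - b) - |A^T v|^2 / 2] gives the
   feasible point [x - A^T v] with [|A^T v|^2 = v.(A x - b)], so that
   [r(A) |A^T v| <= |(A x - b)_+|]; the pairs [(- v, 0)] show that the constant
   is optimal.

   Chi: [M = (A^T D A)^-1 A^T D] satisfies [(A^T w).(M u) = w.u] for every
   [w = D A z].  A signature [S] with [S A z >= 0] turns [w] into the nonnegative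
   vector [S w], whence [|w| <= |A^T w| / r(S A)]; conversely every [S v] with
   [v > 0] has the form [D A z] as soon as [S A z > 0]. *)
Require Import Defs.
From mathcomp Require Import all_boot all_order all_algebra.
From mathcomp Require Import all_classical all_reals all_analysis.
From mathcomp Require Import ring lra.

Set Implicit Arguments.
Unset Strict Implicit.
Unset Printing Implicit Defensive.

Import Order.TTheory GRing.Theory Num.Theory.
Import numFieldNormedType.Exports.

Local Open Scope classical_set_scope.
Local Open Scope ring_scope.

(** * Euclidean inner product and norm *)

Definition dot {R : realType} {d : nat} (u v : 'cV[R]_d) : R := (u^T *m v) 0 0.

Lemma dotE (R : realType) (d : nat) (u v : 'cV[R]_d) :
  dot u v = \sum_i u i 0 * v i 0.
Proof. by rewrite /dot !mxE; apply: eq_bigr => i _; rewrite !mxE. Qed.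

Lemma dotC (R : realType) (d : nat) (u v : 'cV[R]_d) : dot u v = dot v u.
Proof. by rewrite !dotE; apply: eq_bigr => i _; rewrite mulrC. Qed.

Lemma dotDr (R : realType) (d : nat) (u v w : 'cV[R]_d) :
  dot u (v + w) = dot u v + dot u w.
Proof. by rewrite /dot mulmxDr !mxE. Qed.

Lemma dotDl (R : realType) (d : nat) (u v w : 'cV[R]_d) :
  dot (u + v) w = dot u w + dot v w.
Proof. by rewrite !(dotC _ w) dotDr. Qed.

Lemma dotZr (R : realType) (d : nat) (a : R) (u v : 'cV[R]_d) :
  dot u (a *: v) = a * dot u v.
Proof. by rewrite /dot -scalemxAr !mxE. Qed.

Lemma dotZl (R : realType) (d : nat) (a : R) (u v : 'cV[R]_d) :
  dot (a *: u) v = a * dot u v.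
Proof. by rewrite !(dotC _ v) dotZr. Qed.

Lemma dotNr (R : realType) (d : nat) (u v : 'cV[R]_d) :
  dot u (- v) = - dot u v.
Proof. by rewrite -scaleN1r dotZr mulN1r. Qed.

Lemma dotNl (R : realType) (d : nat) (u v : 'cV[R]_d) :
  dot (- u) v = - dot u v.
Proof. by rewrite !(dotC _ v) dotNr. Qed.

Lemma dot_mulmx (R : realType) (m n : nat) (M : 'M[R]_(m, n))
    (u : 'cV[R]_m) (x : 'cV[R]_n) : dot u (M *m x) = dot (M^T *m u) x.
Proof. by rewrite /dot trmx_mul trmxK mulmxA. Qed.

Lemma mulmx_dot (R : realType) (m n : nat) (M : 'M[R]_(m, n))
    (x : 'cV[R]_n) (i : 'I_m) : (M *m x) i 0 = dot (row i M)^T x.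
Proof. by rewrite dotE mxE; apply: eq_bigr => j _; rewrite !mxE. Qed.

Lemma dot_ge0 (R : realType) (d : nat) (u : 'cV[R]_d) : 0 <= dot u u.
Proof. by rewrite dotE sumr_ge0// => i _; rewrite -expr2 sqr_ge0. Qed.

Lemma enormE (R : realType) (d : nat) (u : 'cV[R]_d) :
  enorm u = Num.sqrt (dot u u).
Proof. by rewrite dotE. Qed.

Lemma enorm_ge0 (R : realType) (d : nat) (u : 'cV[R]_d) : 0 <= enorm u.
Proof. exact: sqrtr_ge0. Qed.

Lemma enorm_sqr (R : realType) (d : nat) (u : 'cV[R]_d) :
  enorm u ^+ 2 = dot u u.
Proof. by rewrite enormE sqr_sqrtr// dot_ge0. Qed.

Lemma enorm0 (R : realType) (d : nat) : enorm (0 : 'cV[R]_d) = 0.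
Proof. by rewrite enormE /dot mulmx0 mxE sqrtr0. Qed.

Lemma enorm_eq0 (R : realType) (d : nat) (u : 'cV[R]_d) :
  enorm u = 0 -> u = 0.
Proof.
move=> u0; have := enorm_sqr u; rewrite u0 expr0n/= dotE => /esym/eqP.
rewrite psumr_eq0; last by move=> i _; rewrite -expr2 sqr_ge0.
move=> /allP h; apply/colP => i; rewrite mxE.
by have := h i (mem_index_enum i); rewrite mulf_eq0 orbb => /eqP.
Qed.

Lemma enorm_gt0 (R : realType) (d : nat) (u : 'cV[R]_d) :
  u != 0 -> 0 < enorm u.
Proof.
move=> u0; rewrite lt0r enorm_ge0 andbT; apply: contra u0 => /eqP h.
by apply/eqP/enorm_eq0.
Qed.

Lemma enormZ (R : realType) (d : nat) (a : R) (u : 'cV[R]_d) :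
  enorm (a *: u) = `|a| * enorm u.
Proof.
by rewrite !enormE dotZl dotZr mulrA -expr2 sqrtrM ?sqr_ge0// sqrtr_sqr.
Qed.

Lemma enormN (R : realType) (d : nat) (u : 'cV[R]_d) :
  enorm (- u) = enorm u.
Proof. by rewrite -scaleN1r enormZ normrN1 mul1r. Qed.

(** Cauchy-Schwarz: the square of [enorm v *: u - enorm u *: v] is nonnegative, and its expansion is
    divided by [enorm u * enorm v]. *)
Lemma dot_le (R : realType) (d : nat) (u v : 'cV[R]_d) :
  dot u v <= enorm u * enorm v.
Proof.
have [->|/enorm_gt0 u0] := eqVneq u 0.
  by rewrite enorm0 mul0r /dot trmx0 mul0mx mxE.
have [->|/enorm_gt0 v0] := eqVneq v 0.
  by rewrite enorm0 mulr0 /dot mulmx0 mxE.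
have := dot_ge0 (enorm v *: u - enorm u *: v).
rewrite !(dotDl, dotDr, dotNl, dotNr, dotZl, dotZr) (dotC v u) -!enorm_sqr.
have p0 := mulr_gt0 u0 v0.
by move=> h; rewrite -(ler_pM2l p0); nra.
Qed.

Lemma ler_enormD (R : realType) (d : nat) (u v : 'cV[R]_d) :
  enorm (u + v) <= enorm u + enorm v.
Proof.
rewrite -ler_sqr ?nnegrE ?addr_ge0 ?enorm_ge0// enorm_sqr.
rewrite !(dotDl, dotDr) (dotC v u) -!enorm_sqr.
have := dot_le u v; nra.
Qed.

Lemma ler_enormB (R : realType) (d : nat) (u v : 'cV[R]_d) :
  enorm u - enorm v <= enorm (u + v).
Proof. by have := ler_enormD (u + v) (- v); rewrite addrK enormN; lra. Qed.

Lemma coord_le_enorm (R : realType) (d : nat) (u : 'cV[R]_d) (i : 'I_d) :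
  u i 0 <= enorm u.
Proof.
rewrite (le_trans (ler_norm _))// -sqrtr_sqr ler_sqrt; last first.
  by apply: sumr_ge0 => j _; rewrite sqr_ge0.
by rewrite (bigD1 i)//= lerDl sumr_ge0// => j _; rewrite sqr_ge0.
Qed.

Lemma enorm_le_sum (R : realType) (d : nat) (u : 'cV[R]_d) :
  (forall i, 0 <= u i 0) -> enorm u <= \sum_i u i 0.
Proof.
move=> u0; have s0 : 0 <= \sum_i u i 0 by apply: sumr_ge0.
rewrite -ler_sqr ?nnegrE ?enorm_ge0// enorm_sqr dotE expr2 mulr_suml.
apply: ler_sum => i _; apply: ler_wpM2l => //.
by rewrite (bigD1 i)//= lerDl sumr_ge0.
Qed.

Lemma enorm_le_mono (R : realType) (d : nat) (u v : 'cV[R]_d) :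
  (forall i, 0 <= u i 0 <= v i 0) -> enorm u <= enorm v.
Proof.
move=> uv; rewrite ler_wsqrtr//; apply: ler_sum => i _.
by have /andP[u0 uvi] := uv i; rewrite ler_sqr ?nnegrE// (le_trans u0).
Qed.

(** * Operator norm *)

(** The Frobenius norm serves as [C]. This crude bound shows that the set whose supremum is
    [opnorm M] is bounded above. *)
Lemma enorm_mulmx_bounded (R : realType) (m n : nat) (M : 'M[R]_(m, n)) :
  exists2 C : R, 0 <= C & forall x, enorm (M *m x) <= C * enorm x.
Proof.
pose C := Num.sqrt (\sum_i enorm (row i M)^T ^+ 2).
have s0 : 0 <= \sum_i enorm (row i M)^T ^+ 2.
  by apply: sumr_ge0 => i _; rewrite sqr_ge0.
exists C => [|x]; first exact: sqrtr_ge0.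
rewrite -ler_sqr ?nnegrE ?mulr_ge0 ?enorm_ge0 ?sqrtr_ge0//.
rewrite enorm_sqr dotE exprMn sqr_sqrtr// mulr_suml; apply: ler_sum => i _.
have h1 := dot_le (row i M)^T x; have h2 := dot_le (row i M)^T (- x).
rewrite dotNr enormN in h2; rewrite mulmx_dot -expr2 -exprMn.
have p0 : 0 <= enorm (row i M)^T * enorm x by rewrite mulr_ge0 ?enorm_ge0.
rewrite -real_normK ?num_real// ler_sqr ?nnegrE// ler_norml; apply/andP; split => //; lra.
Qed.

Lemma opnorm_le (R : realType) (m n : nat) (M : 'M[R]_(m, n)) (K : R) :
  0 <= K -> (forall x, enorm (M *m x) <= K * enorm x) -> opnorm M <= K.
Proof.
move=> K0 h; apply: ge_sup.
  by exists (enorm (M *m 0)), 0 => //=; rewrite enorm0.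
by move=> _ [x /= x1 <-]; rewrite (le_trans (h x))// ler_piMr.
Qed.

Lemma enorm_mulmx_le (R : realType) (m n : nat) (M : 'M[R]_(m, n))
    (x : 'cV[R]_n) : enorm (M *m x) <= opnorm M * enorm x.
Proof.
have [->|x0] := eqVneq x 0; first by rewrite mulmx0 !enorm0 mulr0.
have e0 := enorm_gt0 x0.
rewrite -ler_pdivrMr// mulrC -(ger0_norm (ltW _ : 0 <= (enorm x)^-1)) ?invr_gt0//.
rewrite -enormZ scalemxAr; apply: ub_le_sup.
  have [C C0 hC] := enorm_mulmx_bounded M; exists C => _ [y /= y1 <-].
  by rewrite (le_trans (hC y))// ler_piMr.
exists ((enorm x)^-1 *: x) => //=.
by rewrite enormZ ger0_norm ?invr_ge0 ?enorm_ge0// mulVf ?gt_eqF.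
Qed.

Lemma opnorm_ge0 (R : realType) (m n : nat) (M : 'M[R]_(m, n)) : 0 <= opnorm M.
Proof.
have [C C0 hC] := enorm_mulmx_bounded M.
rewrite -(enorm0 R m) -(mulmx0 1 M); apply: ub_le_sup.
  by exists C => _ [y /= y1 <-]; rewrite (le_trans (hC y))// ler_piMr.
by exists 0 => //=; rewrite enorm0.
Qed.

(** With [w = M^T *m u], one has [|w|^2 = u.(M w) <= |u| |M| |w|]; divide by [|w|]. *)
Lemma opnorm_trmx_mulmx_le (R : realType) (m n : nat) (M : 'M[R]_(m, n))
    (u : 'cV[R]_m) : enorm (M^T *m u) <= opnorm M * enorm u.
Proof.
have [->|/enorm_gt0 w0] := eqVneq (M^T *m u) 0.
  by rewrite enorm0 mulr_ge0 ?enorm_ge0 ?opnorm_ge0.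
rewrite -(ler_pM2r w0) -expr2 enorm_sqr -dot_mulmx (le_trans (dot_le _ _))//.
have := ler_wpM2l (enorm_ge0 u) (enorm_mulmx_le M (M^T *m u)); lra.
Qed.


(** * A concave quadratic program over the nonnegative orthant *)

(** A positive first-order term would dominate the second-order one for small [t]. This extracts
    first-order optimality conditions from a maximum. *)
Lemma le0_of_near0 (R : realType) (a b d : R) : 0 < d -> 0 <= b ->
  (forall t, 0 < t <= d -> t * a <= t ^+ 2 * b) -> a <= 0.
Proof.
move=> d0 b0 h; rewrite leNgt; apply/negP => a0.
pose t := Num.min d (a / (2 * (b + 1))).
have b1 : 0 < 2 * (b + 1) by lra.
have t0 : 0 < t by rewrite lt_min d0 divr_gt0.
have td : t <= d by rewrite ge_min lexx.
have : t <= a / (2 * (b + 1)) by rewrite ge_min lexx orbT.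
rewrite ler_pdivlMr// => ta.
have := h t; rewrite t0 td => /(_ isT).
by rewrite expr2 -mulrA ler_pM2l//; nra.
Qed.

Lemma dot_delta (R : realType) (d : nat) (i : 'I_d) (u : 'cV[R]_d) :
  dot (delta_mx i 0) u = u i 0.
Proof.
rewrite dotE (bigD1 i)//= mxE !eqxx mul1r big1 ?addr0// => j /negbTE ji.
by rewrite mxE ji mul0r.
Qed.

Lemma dot_continuous (R : realType) (d : nat) (T : topologicalType)
    (f g : T -> 'cV[R]_d) :
  (forall i, continuous (fun x => f x i 0)) ->
  (forall i, continuous (fun x => g x i 0)) ->
  continuous (fun x => dot (f x) (g x)).
Proof.
move=> cf cg; rewrite (funext (fun x => dotE (f x) (g x))) => x.
apply: cvg_big; first exact: add_continuous.
by move=> i _; apply: cvgM; [exact: cf|exact: cg].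
Qed.

(* The multiplier [v] maximizes the concave function
   [v |-> v.c - |A^T v|^2 / 2] over the nonnegative orthant; the bound
   [r |v| <= |A^T v|] makes it coercive, and the conclusion is its
   first-order optimality condition. *)
Lemma complementarity (R : realType) (m n : nat) (A : 'M[R]_(m, n)) (r : R)
    (c : 'cV[R]_m) : 0 < r ->
  (forall v, nonneg_orthant v -> r * enorm v <= enorm (A^T *m v)) ->
  exists v, [/\ nonneg_orthant v,
    forall i, c i 0 <= (A *m (A^T *m v)) i 0 &
    dot v (c - A *m (A^T *m v)) = 0].
Proof.
move=> r0 hr.
pose f (v : 'cV[R]_m) := dot v c - dot (A^T *m v) (A^T *m v) / 2.
(* Whenever [f v >= 0 = f 0], coercivity gives [|v| <= C - 1]. A maximizer over the box of side [C]
   therefore stays away from its upper faces. *)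
pose C := 2 * enorm c / r ^+ 2 + 1.
have C1 : 1 <= C by rewrite lerDr divr_ge0 ?sqr_ge0// mulr_ge0 ?enorm_ge0.
pose box := [set v : 'rV[R]_m | forall i, `[0, C]%classic (v ord0 i)].
have [u] : exists2 u, u \in box & forall t, t \in box -> f t^T <= f u^T.
  apply: EVT_max_rV.
  - exists 0 => i /=; rewrite mxE in_itv/= lexx/=; lra.
  - by apply: (@rV_compact _ _ (fun=> `[0, C]%classic)) => _; exact: segment_compact.
  apply: continuous_subspaceT.
  have tc i : continuous (fun x : 'rV[R]_m => x^T i 0).
    by under eq_fun do rewrite mxE; exact: coord_continuous.
  have ATc j : continuous (fun x : 'rV[R]_m => (A^T *m x^T) j 0).
    under eq_fun do rewrite mulmx_dot.
    by apply: dot_continuous => // i; exact: cst_continuous.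
  have c1 : continuous (fun x : 'rV[R]_m => dot x^T c).
    by apply: dot_continuous => // i; exact: cst_continuous.
  have c2 : continuous (fun x : 'rV[R]_m => dot (A^T *m x^T) (A^T *m x^T)).
    exact: dot_continuous.
  move=> x; apply: (continuousB (c1 x)).
  by apply: (continuousM (c2 x)); exact: cst_continuous.
rewrite inE => ubox umax; pose v := u^T.
have v0 i : 0 <= v i 0 by have := ubox i; rewrite /= in_itv/= mxE => /andP[].
have vmax (w : 'cV[R]_m) : (forall i, 0 <= w i 0 <= C) -> f w <= f v.
  move=> hw; rewrite -[w]trmxK; apply: umax; rewrite inE => i /=.
  by rewrite in_itv/= mxE.
have vC : enorm v < C.
  have /vmax : forall i : 'I_m, 0 <= (0 : 'cV[R]_m) i 0 <= C.
    by move=> i; rewrite mxE lexx/=; lra.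
  rewrite /f mulmx0 -!enorm_sqr !enorm0 dotC /dot mulmx0 mxE -/(dot _ _).
  rewrite expr0n mul0r subr0 => fv0.
  have [v00|vn0] := eqVneq v 0; first by rewrite v00 enorm0; lra.
  have vpos := enorm_gt0 vn0.
  suff : enorm v <= 2 * enorm c / r ^+ 2 by rewrite /C; lra.
  rewrite ler_pdivlMr ?exprn_gt0// -(ler_pM2l vpos).
  have h1 := dot_le v c; have h2 := hr _ v0.
  have : (r * enorm v) ^+ 2 <= enorm (A^T *m v) ^+ 2.
    by rewrite ler_sqr ?nnegrE ?enorm_ge0// mulr_ge0 ?enorm_ge0// ltW.
  nra.
pose g := c - A *m (A^T *m v).
(* Along an admissible direction, [f (v + t w) - f v = t (w.g) - t^2 |A^T w|^2 / 2] is at most 0. *)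
have dir (w : 'cV[R]_m) d : 0 < d ->
    (forall t, 0 < t <= d -> forall i, 0 <= (v + t *: w) i 0 <= C) ->
    dot w g <= 0.
  move=> d0 hw; apply: (@le0_of_near0 _ _ (dot (A^T *m w) (A^T *m w) / 2) d) => //.
    by rewrite divr_ge0 ?dot_ge0.
  move=> t td; have := vmax _ (hw t td).
  rewrite /f /g !(mulmxDr, =^~ scalemxAr, dotDl, dotDr, dotZl, dotZr, dotNr).
  rewrite (dot_mulmx A w) (dotC (A^T *m v) (A^T *m w)); lra.
(* Raising one coordinate is admissible: each coordinate of [v] is at most [enorm v < C]. *)
have gle0 i : g i 0 <= 0.
  rewrite -dot_delta; apply: (dir _ (C - enorm v)); first lra.
  move=> t /andP[t0 tC] j; have hv := coord_le_enorm v j; have := v0 j.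
  have -> : (v + t *: delta_mx i 0) j 0 = v j 0 + t * (j == i)%:R.
    by rewrite !mxE andbT.
  by case: (j == i) => /= vj; apply/andP; split; lra.
exists v; split => // [i|].
  by have := gle0 i; rewrite !mxE subr_le0.
apply/eqP; rewrite eq_le; apply/andP; split.
  by rewrite dotE sumr_le0// => i _; rewrite mulr_ge0_le0.
(* The reverse inequality uses the direction [- v], along which a step [t <= 1] shrinks [v] inside
   the box. *)
rewrite -oppr_le0 -dotNl; apply: (dir _ 1) => // t /andP[t0 t1] i.
have := coord_le_enorm v i; have := v0 i.
have -> : (v + t *: - v) i 0 = v i 0 - t * v i 0 by rewrite !mxE mulrN.
by move=> vi hv; apply/andP; split; nra.
Qed.

(** * Renegar's distance as the best lower bound for [|A^T v| / |v|] *)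

Lemma norm_dot_le (R : realType) (d : nat) (u v : 'cV[R]_d) :
  `|dot u v| <= enorm u * enorm v.
Proof.
rewrite ler_norml dot_le andbT; have := dot_le u (- v).
by rewrite dotNr enormN; lra.
Qed.

Lemma dot_gt0 (R : realType) (m : nat) (v y : 'cV[R]_m) :
  nonneg_orthant v -> v != 0 -> pos_orthant y -> 0 < dot v y.
Proof.
move=> v0 vn0 y0; rewrite lt0r dotE sumr_ge0 ?andbT; last first.
  by move=> i _; rewrite mulr_ge0// ltW.
rewrite psumr_eq0; last by move=> i _; rewrite mulr_ge0// ltW.
apply: contra vn0 => /allP h; apply/eqP/colP => i; rewrite mxE.
have := h i (mem_index_enum i); rewrite mulf_eq0 [y i 0 == 0]gt_eqF ?orbF//.
by move=> /eqP.
Qed.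

Lemma enorm_const1_gt0 (R : realType) (m : nat) :
  (0 < m)%N -> 0 < enorm (const_mx 1 : 'cV[R]_m).
Proof.
move=> m0; apply: enorm_gt0; apply/eqP => /colP/(_ (Ordinal m0)).
by rewrite !mxE; apply/eqP; exact: oner_neq0.
Qed.

Lemma renegar_le (R : realType) (m n : nat) (A : 'M[R]_(m, n)) (v : 'cV[R]_m) :
  nonneg_orthant v -> renegar A * enorm v <= enorm (A^T *m v).
Proof.
move=> v0; have [->|vn0] := eqVneq v 0; first by rewrite mulmx0 !enorm0 mulr0.
have vpos := enorm_gt0 vn0.
rewrite -ler_pdivlMr//.
(* The rank-one perturbation of least norm that makes [v] orthogonal to the
   column space. *)
pose B := - ((enorm v ^+ 2)^-1 *: (v *m (v^T *m A))).
have BE x : B *m x = - ((enorm v ^+ 2)^-1 * dot v (A *m x)) *: v.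
  rewrite /B mulNmx -scalemxAl -!mulmxA (mx11_scalar (v^T *m _)).
  by rewrite mul_mx_scalar scalerA scaleNr.
apply: (@le_trans _ _ (opnorm B)).
  apply: ge_inf; first by exists 0 => _ [C _ <-]; exact: opnorm_ge0.
  exists B => //=; rewrite -subset0 => _ [[x _ <-] /(dot_gt0 v0 vn0)].
  rewrite mulmxDl BE dotDr dotZr -enorm_sqr mulNr mulrAC mulVf ?mul1r ?subrr ?ltxx//.
  by rewrite sqrf_eq0 gt_eqF.
apply: opnorm_le => [|x]; first by rewrite divr_ge0 ?enorm_ge0.
have i0 : 0 <= (enorm v ^+ 2)^-1 by rewrite invr_ge0 sqr_ge0.
rewrite BE enormZ normrN normrM (ger0_norm i0) dot_mulmx.
have := norm_dot_le (A^T *m v) x; set a := `|_|; set b := enorm _ => h.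
have -> : (enorm v ^+ 2)^-1 * a * enorm v = a / enorm v.
  by field; rewrite gt_eqF.
by rewrite mulrAC ler_pM2r ?invr_gt0.
Qed.

(** If [|B| < r], the transpose of [A + B] is still bounded below on the orthant, by [r - |B|].
    Complementarity with [c] the all-ones vector then yields a point where [A + B] takes values at
    least 1, so [B] does not destroy feasibility. *)
Lemma renegar_ge (R : realType) (m n : nat) (A : 'M[R]_(m, n)) (r : R) :
  (0 < m)%N ->
  (forall v, nonneg_orthant v -> r * enorm v <= enorm (A^T *m v)) ->
  r <= renegar A.
Proof.
move=> m0 hr; apply: lb_le_inf.
  exists (opnorm (- A)), (- A) => //=; rewrite -subset0 => _ [[x _ <-]].
  by move=> /(_ (Ordinal m0)); rewrite subrr mul0mx mxE ltxx.
move=> _ [B /= infeas <-]; rewrite leNgt; apply/negP => Br.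
have r0 : 0 < r - opnorm B by lra.
have [v v0|v [v0 h _]] := @complementarity _ _ _ (A + B) _ (const_mx 1) r0.
  have := hr v v0; have := opnorm_trmx_mulmx_le B v.
  have := ler_enormB (A^T *m v) (B^T *m v).
  by rewrite -mulmxDl -linearD/=; nra.
have : (colspace (A + B) `&` @pos_orthant R m) ((A + B) *m ((A + B)^T *m v)).
  split; first by exists ((A + B)^T *m v).
  by move=> i; have := h i; rewrite mxE; apply: lt_le_trans.
by rewrite infeas.
Qed.

(** For [A x > 0] with entries at least [mu], [mu |v| <= mu * sum v <= v.(A x) <= |A^T v| |x|], so
    [mu / |x|] is an admissible constant in [renegar_ge]. *)
Lemma renegar_gt0 (R : realType) (m n : nat) (A : 'M[R]_(m, n)) :
  (0 < m)%N -> strictly_feasible A -> 0 < renegar A.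
Proof.
move=> m0 [_ [[x _ <-] Ax0]].
pose mu := \big[Num.min/1]_i (A *m x) i 0.
have mu0 : 0 < mu.
  by apply: (big_ind (fun y => 0 < y)) => // a b a0 b0; rewrite lt_min a0.
have muA i : mu <= (A *m x) i 0 by exact: bigmin_le.
have x0 : 0 < enorm x.
  apply: enorm_gt0; apply/eqP => x0; have := Ax0 (Ordinal m0).
  by rewrite x0 mulmx0 mxE ltxx.
apply: (@lt_le_trans _ _ (mu / enorm x)); first by rewrite divr_gt0.
apply: renegar_ge => // v v0.
rewrite mulrAC ler_pdivrMr//.
apply: le_trans (dot_le (A^T *m v) x); rewrite -dot_mulmx.
apply: le_trans (ler_wpM2l (ltW mu0) (enorm_le_sum v0)) _.
by rewrite dotE mulr_sumr; apply: ler_sum => i _; rewrite mulrC ler_wpM2l.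
Qed.

Lemma inv_renegar_le (R : realType) (m n : nat) (A : 'M[R]_(m, n)) (t : R) :
  (0 < m)%N ->
  (forall v, nonneg_orthant v -> enorm v <= t * enorm (A^T *m v)) ->
  1 / renegar A <= t.
Proof.
move=> m0 h; have t0 : 0 < t.
  (* The nonzero all-ones vector excludes [t <= 0]. *)
  have /h : nonneg_orthant (const_mx 1 : 'cV[R]_m) by move=> i; rewrite mxE.
  have := enorm_const1_gt0 R m0; have := enorm_ge0 (A^T *m const_mx 1).
  by rewrite ltNge; move=> *; apply/negP => t0; nra.
have tr : t^-1 <= renegar A.
  by apply: renegar_ge => // v v0; rewrite mulrC ler_pdivrMr// mulrC h.
by rewrite div1r -[t]invrK lef_pV2// posrE ?invr_gt0// (lt_le_trans _ tr) ?invr_gt0.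
Qed.

(** * The Hoffman constant *)

(** Lower bounds on [hoffman] and [chi] can thus be proved against a real upper bound [t], before
    finiteness is known. *)
Lemma le_ereal_sup_ub (R : realType) (E : set \bar R) (k : R) :
  (forall t : R, (forall y, E y -> (y <= t%:E)%E) -> k <= t) ->
  (k%:E <= ereal_sup E)%E.
Proof.
move=> h; have := @ereal_sup_ubound _ E; case: (ereal_sup E) => [r| |] ub.
- by rewrite lee_fin; apply: h => y /ub.
- exact: leey.
- suff : k <= k - 1 by rewrite lerBrDr gerDl ler10.
  by apply: h => y /ub; rewrite leeNy_eq => /eqP ->; exact: leNye.
Qed.

Lemma dot_pospart_le (R : realType) (m : nat) (v y : 'cV[R]_m) :
  nonneg_orthant v -> dot v y <= enorm v * enorm (pospart y).
Proof.
move=> v0; apply: le_trans (dot_le _ _); rewrite !dotE; apply: ler_sum => i _.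
by rewrite ler_wpM2l// mxE le_max lexx.
Qed.

Lemma edist_le (R : realType) (d : nat) (u w : 'cV[R]_d) (T : set 'cV[R]_d) :
  T w -> Defs.edist u T <= enorm (u - w).
Proof.
move=> Tw; apply: ge_inf; last by exists w.
by exists 0 => _ [z _ <-]; exact: enorm_ge0.
Qed.

Lemma hoffman_eq (R : realType) (m n : nat) (A : 'M[R]_(m, n)) :
  (0 < m)%N -> strictly_feasible A -> hoffman A = (1 / renegar A)%:E.
Proof.
move=> m0 sfA; have r0 := renegar_gt0 m0 sfA.
apply/eqP; rewrite eq_le; apply/andP; split.
  apply: ge_ereal_sup => _ [[b x] /= [_ xP] <-]; rewrite lee_fin.
  have [v [v0 h1 h2]] := complementarity (A *m x - b) r0 (@renegar_le _ _ _ A).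
  set w := A^T *m v in h1 h2.
  have yP : polyhedron A b (x - w).
    by move=> i; have := h1 i; rewrite mulmxBr !mxE; lra.
  have p0 : 0 < enorm (pospart (A *m x - b)).
    apply: enorm_gt0; apply/eqP => p0; apply: xP => i.
    have /colP/(_ i) := p0; rewrite !mxE => /eqP; rewrite eq_le => /andP[].
    by rewrite ge_max => /andP[+ _] _; lra.
  rewrite ler_pdivrMr// (le_trans (edist_le _ yP))// opprB addrCA subrr addr0.
  have e1 : enorm w ^+ 2 = dot v (A *m x - b).
    by move: h2; rewrite dotDr dotNr dot_mulmx -/w enorm_sqr; lra.
  have e2 := dot_pospart_le (A *m x - b) v0.
  have e3 := renegar_le A v0; rewrite -/w in e3.
  have w0 := enorm_ge0 w; have [->|wn0] := eqVneq (enorm w) 0.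
    by rewrite mulr_ge0 ?divr_ge0 ?ltW.
  have wpos : 0 < enorm w by rewrite lt0r wn0.
  rewrite mulrAC mul1r ler_pdivlMr// -(ler_pM2l wpos).
  set q := enorm (pospart _) in p0 e2 *; nra.
(* Lower bound: the pair [(- v, 0)] has residual [v], and its numerator is the distance from 0 to
   the set [A y <= - v]. *)
apply: le_ereal_sup_ub => t ub; apply: inv_renegar_le => // v v0.
have [->|vn0] := eqVneq v 0; first by rewrite mulmx0 !enorm0 mulr0.
have vpos := enorm_gt0 vn0.
have wpos : 0 < enorm (A^T *m v).
  by apply: lt_le_trans (renegar_le A v0); rewrite mulr_gt0.
have nP : ~ polyhedron A (- v) 0.
  move=> h; have /eqP := vn0; apply; apply/colP => i; rewrite mxE.
  have := h i; have := v0 i; rewrite mulmx0 !mxE => h1 h2; lra.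
have memb : [set y + z | y in colspace A & z in @nonneg_orthant R m] (- v).
  have [_ [[x _ <-] Ax0]] := sfA.
  (* Scaling [x] so that [k A x >= v] splits [- v] as [A (- k x) + (k A x - v)]; the sum of all
     ratios dominates each one. *)
  have [k k0 hk] : exists2 k : R, 0 < k & forall i, v i 0 <= k * (A *m x) i 0.
    exists (1 + \sum_i v i 0 / (A *m x) i 0).
      rewrite ltr_wpDr// sumr_ge0// => i _.
      by apply: divr_ge0; [exact: v0|exact: ltW (Ax0 _)].
    move=> i; rewrite -ler_pdivrMr//.
    rewrite (bigD1 i)//= addrCA lerDl addr_ge0// sumr_ge0// => j _.
    by apply: divr_ge0; [exact: v0|exact: ltW (Ax0 _)].
  exists (A *m (- k *: x)); first by exists (- k *: x).
  exists (k *: (A *m x) - v).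
    by move=> i; have := hk i; rewrite !mxE subr_ge0.
  by rewrite -scalemxAr scaleNr addrA addNr add0r.
have := ub _ (ex_intro2 _ _ (- v, 0) (conj memb nP) erefl).
rewrite /= lee_fin mulmx0 sub0r opprK.
have -> : pospart v = v.
  by apply/colP => i; rewrite mxE; apply/max_idPl.
rewrite -ler_pdivrMr//; apply: le_trans.
rewrite ler_pdivlMr//; apply: lb_le_inf.
  (* The infimum defining the distance runs over a nonempty set: complementarity with [c = v] makes
     [- A^T v'] feasible. *)
  have [v' [_ h _]] := complementarity v r0 (@renegar_le _ _ _ A).
  exists (enorm (0 - - (A^T *m v'))), (- (A^T *m v')) => //= i.
  by rewrite mulmxN !mxE lerN2; have := h i; rewrite mxE.
(* Every feasible [y] satisfies [|v|^2 <= - v.(A y) <= |A^T v| |y|]. *)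
move=> _ [y yP <-]; rewrite sub0r enormN mulrAC ler_pdivrMr//.
rewrite -expr2 enorm_sqr (@le_trans _ _ (- dot v (A *m y)))//.
  rewrite -dotNr !dotE; apply: ler_sum => i _; rewrite ler_wpM2l//.
  by have := yP i; rewrite !mxE; lra.
by rewrite dot_mulmx; have := dot_le (A^T *m v) (- y); rewrite dotNr enormN mulrC.
Qed.

(** * Weighted pseudo-inverses and the lower bound on chi *)

Lemma diag_mulmxE (R : realType) (m : nat) (d : 'rV[R]_m) (x : 'cV[R]_m) i :
  (diag_mx d *m x) i 0 = d 0 i * x i 0.
Proof. by rewrite mul_diag_mx mxE. Qed.

(** If [w] is in the left kernel, the weighted sum of squares of the entries of [A *m w^T] vanishes,
    so [A *m w^T = 0], and full column rank gives [w = 0]. *)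
Lemma gram_unitmx (R : realType) (m n : nat) (A : 'M[R]_(m, n)) (d : 'rV[R]_m) :
  \rank A = n -> (forall i, 0 < d 0 i) -> A^T *m diag_mx d *m A \in unitmx.
Proof.
move=> rkA d0; rewrite -row_free_unit; apply: inj_row_free => w wG.
have : w *m (A^T *m diag_mx d *m A) *m w^T = 0 by rewrite wG mul0mx.
have -> : w *m (A^T *m diag_mx d *m A) *m w^T
    = (A *m w^T)^T *m (diag_mx d *m (A *m w^T)).
  by rewrite trmx_mul trmxK !mulmxA.
move=> /matrixP/(_ 0 0)/eqP; rewrite -/(dot _ _) dotE [X in _ == X]mxE.
rewrite psumr_eq0 => [/allP h|i _]; last first.
  by rewrite diag_mulmxE mulrCA mulr_ge0 ?(ltW (d0 i))// -expr2 sqr_ge0.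
have Aw0 : A *m w^T = 0.
  apply/colP => i; have := h i (mem_index_enum i).
  rewrite diag_mulmxE mulrCA mulf_eq0 gt_eqF//= mulf_eq0 orbb.
  by move=> /eqP ->; rewrite mxE.
have : w *m A^T = 0 by rewrite -[w]trmxK -trmx_mul Aw0 trmx0.
by move=> /eqP; rewrite mulmx_free_eq0 ?/row_free ?mxrank_tr ?rkA// => /eqP.
Qed.

(* [A *m M], for [M] the weighted pseudo-inverse below, is the projection onto
   the column space of [A] orthogonal for the inner product weighted by [D]. *)
Lemma weighted_pinv_dot (R : realType) (m n : nat) (A : 'M[R]_(m, n))
    (d : 'rV[R]_m) (z : 'cV[R]_n) (u : 'cV[R]_m) :
  \rank A = n -> (forall i, 0 < d 0 i) ->
  dot (A^T *m (diag_mx d *m (A *m z)))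
      (invmx (A^T *m diag_mx d *m A) *m A^T *m diag_mx d *m u)
  = dot (diag_mx d *m (A *m z)) u.
Proof.
move=> rkA d0; have := gram_unitmx rkA d0; set G := _ *m A => Gu.
have GT : G^T = G by rewrite /G !trmx_mul trmxK tr_diag_mx mulmxA.
have -> : A^T *m (diag_mx d *m (A *m z)) = G *m z by rewrite /G !mulmxA.
have -> : diag_mx d *m (A *m z) = (A^T *m diag_mx d)^T *m z.
  by rewrite trmx_mul trmxK tr_diag_mx mulmxA.
rewrite dotC dot_mulmx GT -(mulmxA (_ *m A^T)) -(mulmxA (invmx G)) mulKVmx//.
by rewrite [RHS]dotC dot_mulmx trmxK mulmxA.
Qed.

Lemma signature_enorm (R : realType) (m : nat) (s : 'rV[R]_m) (v : 'cV[R]_m) :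
  (forall i, s 0 i = -1 \/ s 0 i = 1) -> enorm (diag_mx s *m v) = enorm v.
Proof.
move=> hs; congr Num.sqrt; apply: eq_bigr => i _.
by rewrite diag_mulmxE; case: (hs i) => ->; rewrite ?mulN1r ?mul1r ?sqrrN.
Qed.

(** A density argument: [v] is shifted into the open orthant by a small multiple of the all-ones
    vector. Positivity is what later allows the entries to define weights in [posdiag_mx]. *)
Lemma enorm_le_orthant (R : realType) (m n : nat) (B : 'M[R]_(n, m)) (t : R) :
  (0 < m)%N ->
  (forall v, pos_orthant v -> enorm v <= t * enorm (B *m v)) ->
  forall v, nonneg_orthant v -> enorm v <= t * enorm (B *m v).
Proof.
move=> m0 pos v v0.
have t0 : 0 <= t.
  have /pos : pos_orthant (const_mx 1 : 'cV[R]_m) by move=> i; rewrite mxE.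
  have := enorm_const1_gt0 R m0; have := enorm_ge0 (B *m const_mx 1).
  by move=> *; rewrite leNgt; apply/negP => t0; nra.
apply/ler_addgt0Pr => e e0.
(* With the shift [e / k], the error on the right-hand side is at most [e]; the added 1 keeps [k]
   positive. *)
pose k := t * enorm (B *m const_mx 1) + 1.
have k0 : 0 < k by rewrite ltr_wpDl// mulr_ge0 ?enorm_ge0.
have ek0 : 0 < e / k by rewrite divr_gt0.
pose v' := v + (e / k) *: const_mx 1.
have v'0 : pos_orthant v'.
  by move=> i; have := v0 i; rewrite !mxE mulr1 => vi; rewrite ltr_wpDl.
apply: (@le_trans _ _ (enorm v')).
  apply: enorm_le_mono => i; have := v0 i; rewrite /v' !mxE mulr1 => ->.
  by rewrite lerDl ltW.
apply: le_trans (pos _ v'0) _.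
apply: le_trans (ler_wpM2l t0 _) _; first by rewrite mulmxDr; exact: ler_enormD.
rewrite mulrDr lerD2l -scalemxAr enormZ gtr0_norm// mulrCA mulrAC ler_pdivrMr//.
by rewrite ler_pM2l// /k lerDl.
Qed.

Lemma inv_renegar_le_chi (R : realType) (m n : nat) (A : 'M[R]_(m, n))
    (S : 'M[R]_m) :
  (0 < m)%N -> \rank A = n -> signature_mx S -> strictly_feasible (S *m A) ->
  ((1 / renegar (S *m A))%:E <= chi A)%E.
Proof.
move=> m0 rkA [s hs <-] [_ [[z _ <-] sz0]].
apply: le_ereal_sup_ub => t ub; apply: inv_renegar_le => //.
apply: enorm_le_orthant => // v' v'0.
pose a := A *m z.
have sa i : 0 < s 0 i * a i 0.
  by have := sz0 i; rewrite -mulmxA diag_mulmxE.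
(* These weights make [D A z] equal to the signed vector [S v']. *)
pose d : 'rV[R]_m := \row_i (v' i 0 / (s 0 i * a i 0)).
have d0 i : 0 < d 0 i by rewrite mxE divr_gt0//; exact: v'0.
have dE : diag_mx d *m a = diag_mx s *m v'.
  apply/colP => i; rewrite !diag_mulmxE [d 0 i]mxE.
  have := sa i; case: (hs i) => ->; rewrite ?mulN1r ?mul1r => ai0.
    by field; rewrite -oppr_eq0 gt_eqF.
  by field; rewrite gt_eqF.
have := ub _ (ex_intro2 _ _ (diag_mx d) (ex_intro2 _ _ d d0 erefl) erefl).
rewrite lee_fin; set M := invmx _ *m _ *m _ => Mt.
(* Pairing [S v'] with itself gives [|v'|^2 = (A^T S v').(M S v') <= |A^T S v'| t |v'|]. *)
have := weighted_pinv_dot z (diag_mx s *m v') rkA d0; rewrite -/M -/a dE.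
rewrite -enorm_sqr signature_enorm// trmx_mul tr_diag_mx mulmxA => e.
have v'pos : 0 < enorm v'.
  apply: enorm_gt0; apply/eqP => v'00; have := v'0 (Ordinal m0).
  by rewrite v'00 mxE ltxx.
have h1 := dot_le (A^T *m diag_mx s *m v') (M *m (diag_mx s *m v')).
have h2 := enorm_mulmx_le M (diag_mx s *m v'); rewrite signature_enorm// in h2.
have h3 : enorm (M *m (diag_mx s *m v')) <= t * enorm v'.
  by rewrite (le_trans h2)// ler_pM2r.
rewrite -mulmxA in e *.
rewrite -mulmxA e in h1.
have := ler_wpM2l (enorm_ge0 (A^T *m (diag_mx s *m v'))) h3.
by move=> h4; rewrite -(ler_pM2r v'pos); lra.
Qed.

(** * Generic points and signatures adapted to a vector *)

Lemma exists_nonroot (R : numDomainType) (p : {poly R}) :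
  p != 0 -> exists t, ~~ root p t.
Proof.
move=> p0; apply: contrapT => h.
have := @max_poly_roots _ p [seq i%:R | i <- iota 0 (size p)] p0.
rewrite size_map size_iota ltnn => H; suff : false by [].
apply: H; last by rewrite map_inj_uniq ?iota_uniq// => i j /eqP; rewrite eqr_nat => /eqP.
by apply/allP => t _; apply: contrapT => nt; apply: h; exists t; apply/negP.
Qed.

(* A point on the moment curve [(1, t, t ^+ 2, ...)] avoids finitely many
   hyperplanes. *)
Lemma exists_generic_point (R : realType) (m n : nat) (A : 'M[R]_(m, n)) :
  (forall i, row i A != 0) -> exists z : 'cV[R]_n, forall i, (A *m z) i 0 != 0.
Proof.
move=> rA; have p0 : \prod_i rVpoly (row i A) != 0.
  apply/prodf_neq0 => i _; apply: contra (rA i) => /eqP r0.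
  by rewrite -[row i A]rVpolyK r0 linear0.
have [t pt] := exists_nonroot p0; exists (\col_j t ^+ j) => i.
apply: contra pt => /eqP Ai0; rewrite /root horner_prod (bigD1 i)//=.
rewrite (@horner_coef_wide _ n) ?size_poly// mulf_eq0; apply/orP; left.
rewrite -[X in _ == X]Ai0 mxE; apply/eqP/eq_bigr => j _.
by rewrite coef_rVpoly_ord !mxE.
Qed.

Lemma exists_small_step (R : realFieldType) (m : nat) (a b : 'I_m -> R) :
  exists2 e : R, 0 < e & forall i, 0 < a i -> 0 < a i + e * b i.
Proof.
(* [k] exceeds [|b i| / a i] whenever [a i > 0]; absolute values keep the terms of the other indices
   nonnegative. *)
pose k := 1 + \sum_i `|b i| / `|a i|.
have k0 : 0 < k.
  by rewrite ltr_wpDr// sumr_ge0// => i _; rewrite divr_ge0.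
exists k^-1; rewrite ?invr_gt0// => i ai.
rewrite -[X in 0 < X](mulfK (lt0r_neq0 k0)) divr_gt0// mulrDl mulrAC mulVf ?lt0r_neq0//.
have : `|b i| < a i * k.
  rewrite -ltr_pdivrMl// mulrC -{1}(gtr0_norm ai) /k (bigD1 i)//= addrCA ltrDl.
  by rewrite ltr_wpDr// sumr_ge0// => j _; rewrite divr_ge0.
by rewrite ltr_norml mul1r => /andP[]; lra.
Qed.

(** The signs follow [A z] where it is nonzero and a generic [A z0] elsewhere. A small step from [z]
    towards [z0] then makes every signed entry positive. *)
Lemma exists_feasible_signature (R : realType) (m n : nat) (A : 'M[R]_(m, n))
    (z : 'cV[R]_n) : (forall i, row i A != 0) ->
  exists S, [/\ signature_mx S, strictly_feasible (S *m A) &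
                nonneg_orthant (S *m (A *m z))].
Proof.
move=> /exists_generic_point[z0 z0P].
pose a := A *m z; pose b := A *m z0.
pose s : 'rV[R]_m := \row_i (if a i 0 == 0 then Num.sg (b i 0) else Num.sg (a i 0)).
have sgP (x : R) : x != 0 -> Num.sg x = -1 \/ Num.sg x = 1.
  by case: sgrP => //; [right|left].
have sP i : s 0 i = -1 \/ s 0 i = 1.
  by rewrite mxE; have [_|ai0] := eqVneq (a i 0) 0; apply: sgP => //; exact: z0P.
have [e e0 he] := exists_small_step (fun i => `|a i 0|) (fun i => s 0 i * b i 0).
exists (diag_mx s); split.
- by exists s.
- exists (diag_mx s *m A *m (z + e *: z0)); split; first by exists (z + e *: z0).
  move=> i; rewrite -mulmxA diag_mulmxE mulmxDr -scalemxAr [X in _ * X]mxE.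
  rewrite [X in _ + X]mxE -/a -/b mulrDr mulrCA.
  have := he i; rewrite [s 0 i]mxE; have [->|ai0] := eqVneq (a i 0) 0 => h.
    by rewrite mulr0 add0r mulr_gt0// -normrEsg normr_gt0; exact: z0P.
  by rewrite -normrEsg; apply: h; rewrite normr_gt0.
move=> i; rewrite diag_mulmxE -/a [s 0 i]mxE; have [->|_] := eqVneq (a i 0) 0.
  by rewrite mulr0.
by rewrite -normrEsg.
Qed.

(** * Upper bound on chi and attainment of the maximum *)

Lemma chi_le (R : realType) (m n : nat) (A : 'M[R]_(m, n)) (K : R) :
  (0 < m)%N -> \rank A = n -> (forall i, row i A != 0) ->
  (forall S, signature_mx S -> strictly_feasible (S *m A) ->
    1 / renegar (S *m A) <= K) ->
  (chi A <= K%:E)%E.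
Proof.
move=> m0 rkA rA hK; have K0 : 0 <= K.
  have [S [SS SA _]] := exists_feasible_signature 0 rA.
  by apply: le_trans (hK _ SS SA); rewrite divr_ge0// ltW// renegar_gt0.
apply: ge_ereal_sup => _ [_ [d d0 <-] <-]; rewrite lee_fin.
set M := invmx _ *m _ *m _; apply: opnorm_le => // u.
set y := M *m u.
(* This choice gives [A^T w = y], so [weighted_pinv_dot] reads [|y|^2 = w.u]; bounding [|w|] by
   [K |y|] then suffices. *)
pose z := invmx (A^T *m diag_mx d *m A) *m y.
pose w := diag_mx d *m (A *m z).
have ATw : A^T *m w = y.
  by rewrite /w /z !mulmxA mulmxV ?mul1mx//; exact: gram_unitmx.
have e := weighted_pinv_dot z u rkA d0.
rewrite -/w ATw -/M -/y -enorm_sqr in e.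
have [_ [[s hs <-] sA nn]] := exists_feasible_signature z rA.
have r0 := renegar_gt0 m0 sA.
have hKs := hK _ (ex_intro2 _ _ s hs erefl) sA.
have w0 : nonneg_orthant (diag_mx s *m w).
  move=> i; have := nn i; rewrite /w !diag_mulmxE !mxE => h.
  by rewrite mulrCA mulr_ge0// ltW//.
have := renegar_le (diag_mx s *m A) w0.
(* As [S] is an involution, [(S A)^T (S w) = A^T w = y]. *)
have ss : diag_mx s *m diag_mx s = 1%:M.
  rewrite mulmx_diag -diag_const_mx; congr diag_mx; apply/rowP => i.
  by rewrite !mxE; case: (hs i) => ->; rewrite ?mulrNN mulr1.
rewrite signature_enorm// trmx_mul tr_diag_mx -mulmxA (mulmxA (diag_mx s)) ss mul1mx ATw.
move=> h1.
have wK : enorm w <= K * enorm y.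
  apply: (@le_trans _ _ (1 / renegar (diag_mx s *m A) * enorm y)).
    by rewrite div1r ler_pdivlMl.
  by rewrite ler_wpM2r ?enorm_ge0.
have [->|yn0] := eqVneq (enorm y) 0; first by rewrite mulr_ge0 ?enorm_ge0.
have ypos : 0 < enorm y by rewrite lt0r yn0 enorm_ge0.
rewrite -(ler_pM2r ypos) -expr2 e (le_trans (dot_le _ _))//.
by rewrite mulrAC ler_wpM2r ?enorm_ge0.
Qed.

Lemma chi_is_max (R : realType) (m n : nat) (A : 'M[R]_(m, n)) :
  (0 < m)%N -> \rank A = n -> (forall i, row i A != 0) ->
  is_max [set (1 / renegar (S *m A))%:E
         | S in [set S | signature_mx S /\ strictly_feasible (S *m A)]]
    (chi A).
Proof.
move=> m0 rkA rA; split; last first.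
  by move=> _ [S [SS SA] <-]; exact: inv_renegar_le_chi.
(* Indexing signatures by a finite type provides a maximizer among the feasible ones. *)
pose sgn (f : {ffun 'I_m -> bool}) : 'M[R]_m :=
  diag_mx (\row_i (if f i then 1 else -1)).
have sgnS f : signature_mx (sgn f).
  by eexists; last reflexivity; move=> i; rewrite mxE; case: ifP; [right|left].
have sgn_surj S : signature_mx S -> exists f, S = sgn f.
  move=> [s hs <-]; exists [ffun i => s 0 i == 1]; congr diag_mx.
  apply/rowP => i; rewrite mxE ffunE; case: eqP => // h.
  by case: (hs i).
have [S0 [/sgn_surj[f0 ->] f0P _]] := exists_feasible_signature 0 rA.
pose feasible f := `[< strictly_feasible (sgn f *m A) >].
have f0F : feasible f0 by exact/asboolP.
have [f /asboolP fP fmax] :=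
  arg_maxP (fun f => 1 / renegar (sgn f *m A)) f0F.
exists (sgn f) => //; apply/eqP; rewrite eq_le inv_renegar_le_chi//=.
apply: chi_le => // S /sgn_surj[g ->] gP; apply: fmax.
exact/asboolP.
Qed.

Theorem proposition5 (R : realType) (m n : nat) (hm : (0 < m)%N)
    (hn : (0 < n)%N) (A : 'M[R]_(m, n)) (hA : \rank A = n) :
  (strictly_feasible A -> hoffman A = (1 / renegar A)%:E) /\
  ((forall i : 'I_m, row i A != 0) ->
     is_max [set (1 / renegar (S *m A))%:E
            | S in [set S : 'M[R]_m |
                     @signature_mx R m S /\ strictly_feasible (S *m A)]]
       (chi A)).
Proof.
split; first exact: hoffman_eq.
exact: chi_is_max.
Qed.
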